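(* Let $R$ be a non-commutative ring with unity, let $4\le n\le 6$, and let $A\in M_n(R)$. Then $A$ is a (finite) sum of seventh powers of matrices in $M_n(R)$ if and only if $\operatorname{tr}(A)$ is the sum of a seventh power $c^7$ of an element $c\in R$ and finitely many cyclic sums $C(a_1,a_2,\dots,a_7)$ with $a_1,\dots,a_7\in R$.
   Context: $M_n(R)$ is the ring of $n\times n$ matrices over $R$, and $\operatorname{tr}$ denotes the sum of the diagonal entries. For $a_1,\dots,a_7\in R$ the cyclic sum (''seven-cycle'') $C(a_1,\dots,a_7)$ is the sum of the seven products obtained by cyclically rotating the word $a_1a_2\cdots a_7$: $$C(a_1,\dots,a_7)=\sum_{k=1}^{7} a_k a_{k+1}\cdots a_7a_1\cdots a_{k-1}.$$ *)

(* Defs.v *)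
From mathcomp Require Import all_boot all_algebra.

Set Implicit Arguments.
Unset Strict Implicit.
Unset Printing Implicit Defensive.

Import GRing.Theory.
Local Open Scope ring_scope.

(* C(a_1, ..., a_7).  [rot k a] is the word a_{k+1} ... a_7 a_1 ... a_k and the
   big product multiplies its letters from left to right, so the order of the
   factors is kept although [R] need not be commutative. *)
Definition seven_cycle (R : pzRingType) (a : 7.-tuple R) : R :=
  \sum_(k < 7) \prod_(x <- rot k a) x.

(* Main.v *)
(** The sums of seven-cycles form the additive subgroup [7 R + [R, R]], since
    the seven rotations of a word differ by commutators.

    If [A] is a sum of seventh powers: in any ring [(x + y)^7] equals
    [x^7 + y^7] up to seven-cycles, because the mixed binary words of length 7
    fall into free orbits under rotation.  Applied in the matrix ring to
    [B = \sum_(i, j) b_ij E_ij], this gives [\tr (B^7) = \sum_i b_ii^7] up to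
    seven-cycles; applied in [R], it merges the seventh powers into one.

    Conversely, idempotents are seventh powers.  The idempotents
    [E_ii + x E_ij] and [u w], where [w u = 1], produce every matrix [x E_ij]
    with [i != j] and every [x y E_ii - y x E_jj], so that only the trace
    modulo commutators matters.  The multiples of 7 come from a loop attached
    to a cycle of length 4, whose only closed walks of length 7 through the
    cycle go round it once; this is where [4 <= n] is used. *)
Require Import Defs.
From mathcomp Require Import all_boot all_algebra.

Set Implicit Arguments.
Unset Strict Implicit.
Unset Printing Implicit Defensive.

Import GRing.Theory.
Local Open Scope ring_scope.

(** * Sums of seven-cycles as an additive subgroup *)

Definition cycle_sum {R : pzRingType} (x : R) : Prop :=
  exists t : seq (7.-tuple R), x = \sum_(a <- t) seven_cycle a.

Definition power_sum {R : pzRingType} (x : R) : Prop :=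
  exists s : seq R, x = \sum_(b <- s) b ^+ 7.

Section CycleSum.
Variable R : pzRingType.
Implicit Types x y : R.

(** The sign -1 is central and each word has an odd number of letters, so negating all letters
    negates the product. *)
Lemma seven_cycleN (a : 7.-tuple R) :
  seven_cycle (map_tuple -%R a) = - seven_cycle a.
Proof.
rewrite /seven_cycle -sumrN; apply: eq_bigr => k _.
rewrite -map_rot big_map.
have -> : \prod_(x <- rot k a) - x =
          (-1) ^+ size (rot k a) * \prod_(x <- rot k a) x.
  elim: (rot k a) => [|x s IHs]; first by rewrite !big_nil mulr1.
  by rewrite !big_cons IHs /= exprS mulN1r !mulNr !mulrA commr_sign.
by rewrite size_rot size_tuple -signr_odd /= expr1 mulN1r.
Qed.

(** Cutting the word at [k] gives [p = uv], and the rotation is [vu = uv + (vu - uv)]. *)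
Lemma seven_cycleE (a : 7.-tuple R) (p := \prod_(x <- a) x) :
  seven_cycle a = p *+ 7 + \sum_(k < 7)
    ((\prod_(x <- drop k a) x) * (\prod_(x <- take k a) x) -
     (\prod_(x <- take k a) x) * (\prod_(x <- drop k a) x)).
Proof.
rewrite -[X in p *+ X](card_ord 7) -sumr_const -big_split /=.
apply: eq_bigr => k _; rewrite /rot big_cat /=.
have -> : p = (\prod_(x <- take k a) x) * (\prod_(x <- drop k a) x).
  by rewrite -big_cat cat_take_drop.
by rewrite addrC subrK.
Qed.

Lemma cycle_sum_cycle (a : 7.-tuple R) : cycle_sum (seven_cycle a).
Proof. by exists [:: a]; rewrite big_seq1. Qed.

Lemma cycle_sum0 : cycle_sum (0 : R).
Proof. by exists [::]; rewrite big_nil. Qed.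

Lemma cycle_sumD x y : cycle_sum x -> cycle_sum y -> cycle_sum (x + y).
Proof. by move=> [s ->] [t ->]; exists (s ++ t); rewrite big_cat. Qed.

Lemma cycle_sumN x : cycle_sum x -> cycle_sum (- x).
Proof.
move=> [t ->]; exists [seq map_tuple -%R a | a : 7.-tuple R <- t].
by rewrite big_map -sumrN; apply: eq_bigr => a _; rewrite seven_cycleN.
Qed.

Lemma cycle_sum_sum (I : Type) (s : seq I) (P : pred I) (F : I -> R) :
  (forall i, cycle_sum (F i)) -> cycle_sum (\sum_(i <- s | P i) F i).
Proof.
move=> cF; apply: big_ind => //; [exact: cycle_sum0 | exact: cycle_sumD].
Qed.

Lemma seven_cycle_xy x y :
  seven_cycle [tuple x; y; 1; 1; 1; 1; 1] = (x * y) *+ 6 + y * x.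
Proof.
rewrite /seven_cycle !big_ord_recl big_ord0 /rot /= !big_cons !big_nil.
by rewrite !(mulr1, mul1r) addr0 [y * x + _]addrC addrA.
Qed.

Lemma cycle_sum_mul7 x : cycle_sum (x *+ 7).
Proof.
have := cycle_sum_cycle [tuple x; 1; 1; 1; 1; 1; 1].
by rewrite seven_cycle_xy mulr1 mul1r -mulrSr.
Qed.

Lemma cycle_sum_comm x y : cycle_sum (x * y - y * x).
Proof.
have -> : x * y - y * x =
          (x * y) *+ 7 - seven_cycle [tuple x; y; 1; 1; 1; 1; 1].
  by rewrite seven_cycle_xy opprD addrA mulrS addrK.
by apply: cycle_sumD (cycle_sum_mul7 _) (cycle_sumN (cycle_sum_cycle _)).
Qed.

(** By [seven_cycleE], multiples of 7 and commutators generate all sums of seven-cycles, so a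
    property stable under addition is checked on these alone. *)
Lemma cycle_sum_ind (P : R -> Prop) :
  P 0 -> (forall x y, P x -> P y -> P (x + y)) ->
  (forall x, P (x *+ 7)) -> (forall x y, P (x * y - y * x)) ->
  forall x, cycle_sum x -> P x.
Proof.
move=> P0 PD P7 Pcomm _ [t ->]; apply: (big_ind P) => // a _.
by rewrite seven_cycleE; apply: (PD) => //; apply: big_ind.
Qed.

(** * Seventh powers are additive up to seven-cycles *)

Definition binary_words n : seq (seq bool) :=
  iter n (fun s => map (cons true) s ++ map (cons false) s) [:: [::]].

Lemma exprD_words x y n :
  (x + y) ^+ n =
  \sum_(w <- binary_words n) \prod_(b <- w) (if b : bool then x else y).
Proof.
elim: n => [|n IHn]; first by rewrite expr0 big_seq1 big_nil.
rewrite exprS mulrDl IHn /= big_cat !big_map !big_distrr /=.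
by congr (_ + _); apply: eq_bigr => w _; rewrite big_cons.
Qed.

(** One representative per rotation orbit of non-constant words: a word is kept only if none of its
    rotations was kept before. *)
Definition binary_necklaces : seq (seq bool) :=
  foldr (fun w acc =>
           if constant w || has (fun k => rot k w \in acc) (iota 0 7)
           then acc else w :: acc)
        [::] (binary_words 7).

(** As 7 is prime, a non-constant word has seven distinct rotations; the decomposition into orbits
    is checked by computation. *)
Lemma binary_words7_perm :
  perm_eq (binary_words 7)
    (nseq 7 true :: nseq 7 false ::
     flatten [seq [seq rot k w | k <- iota 0 7] | w <- binary_necklaces]).
Proof. by vm_compute. Qed.

Lemma expr7D x y :
  (x + y) ^+ 7 = x ^+ 7 + (y ^+ 7 +
    \sum_(w <- binary_necklaces) \sum_(k < 7)
      \prod_(b <- rot k w) (if b : bool then x else y)).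
Proof.
rewrite exprD_words (perm_big _ binary_words7_perm).
rewrite [LHS]big_cons; congr (_ + _).
  by rewrite big_nseq -Monoid.iteropE.
rewrite [LHS]big_cons; congr (_ + _).
  by rewrite big_nseq -Monoid.iteropE.
rewrite big_flatten big_map; apply: eq_bigr => w _.
by rewrite big_map -[iota 0 7]/(index_iota 0 7) big_mkord.
Qed.

Lemma cycle_sum_expr7D x y : cycle_sum ((x + y) ^+ 7 - (x ^+ 7 + y ^+ 7)).
Proof.
rewrite expr7D [X in X - _]addrA [X in X - _]addrC addrK big_seq.
apply: big_ind => [||w]; [exact: cycle_sum0 | exact: cycle_sumD |].
have /allP sz7 : all (fun w => size w == 7) binary_necklaces by vm_compute.
move=> /sz7 szw; have := cycle_sum_cycle
  (map_tuple (fun b : bool => if b then x else y) (Tuple szw)).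
congr cycle_sum; apply: eq_bigr => k _.
by rewrite -map_rot big_map.
Qed.

Lemma cycle_sum_expr7_sum (I : Type) (s : seq I) (F : I -> R) :
  cycle_sum ((\sum_(i <- s) F i) ^+ 7 - \sum_(i <- s) F i ^+ 7).
Proof.
elim: s => [|i s IHs].
  by rewrite !big_nil expr0n subr0; exact: cycle_sum0.
rewrite !big_cons.
have := cycle_sumD (cycle_sum_expr7D (F i) (\sum_(j <- s) F j)) IHs.
by rewrite opprD !addrA subrK opprD addrA.
Qed.

End CycleSum.

(** * Sums of seventh powers as an additive subgroup *)

Section PowerSum.
Variable R : pzRingType.
Implicit Types x y : R.

Lemma power_sum_expr7 x : power_sum (x ^+ 7).
Proof. by exists [:: x]; rewrite big_seq1. Qed.

Lemma power_sum0 : power_sum (0 : R).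
Proof. by exists [::]; rewrite big_nil. Qed.

Lemma power_sumD x y : power_sum x -> power_sum y -> power_sum (x + y).
Proof. by move=> [s ->] [t ->]; exists (s ++ t); rewrite big_cat. Qed.

Lemma power_sumN x : power_sum x -> power_sum (- x).
Proof.
move=> [s ->]; exists (map -%R s); rewrite big_map -sumrN.
by apply: eq_bigr => b _; rewrite exprNn -signr_odd /= expr1 mulN1r.
Qed.

Lemma power_sumB x y : power_sum x -> power_sum y -> power_sum (x - y).
Proof. by move=> Sx /power_sumN; exact: power_sumD. Qed.

Lemma power_sum_sum (I : Type) (s : seq I) (P : pred I) (F : I -> R) :
  (forall i, P i -> power_sum (F i)) -> power_sum (\sum_(i <- s | P i) F i).
Proof.
move=> SF; apply: big_ind => //; [exact: power_sum0 | exact: power_sumD].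
Qed.

Lemma power_sum_idem x : x * x = x -> power_sum x.
Proof.
by move=> xx; have := power_sum_expr7 x; rewrite !exprS expr0 mulr1 !xx.
Qed.

End PowerSum.

(** * Traces and matrix units *)

Section Matrix.
Variable R : pzRingType.
Implicit Types x y : R.

Lemma mx_mulrE n (A B : 'M[R]_n) i j : (A * B) i j = \sum_k A i k * B k j.
Proof. exact: mxE. Qed.

Lemma mxtrace_mul n (A B : 'M[R]_n) :
  \tr (A * B) = \sum_i \sum_j A i j * B j i.
Proof. by apply: eq_bigr => i _; exact: mx_mulrE. Qed.

Lemma mxtrace_comm n (A B : 'M[R]_n) : cycle_sum (\tr (A * B - B * A)).
Proof.
(* Exchanging the sums in the second trace pairs [A i j * B j i] with [B j i * A i j], so each term
   is a commutator in [R]. *)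
rewrite raddfB /= !mxtrace_mul [X in _ - X]exchange_big -sumrB.
apply: cycle_sum_sum => i; rewrite -sumrB.
by apply: cycle_sum_sum => j; exact: cycle_sum_comm.
Qed.

Lemma mxtrace_cycle_sum n (A : 'M[R]_n) : cycle_sum A -> cycle_sum (\tr A).
Proof.
move: A; apply: cycle_sum_ind => [|A B SA SB|A|A B].
- by rewrite raddf0; exact: cycle_sum0.
- by rewrite raddfD; exact: cycle_sumD.
- by rewrite raddfMn; exact: cycle_sum_mul7.
- exact: mxtrace_comm.
Qed.

Definition smx n x (i j : 'I_n) : 'M[R]_n := x *: delta_mx i j.

Lemma smxE n x (i j k l : 'I_n) : smx x i j k l = x *+ ((k == i) && (l == j)).
Proof. by rewrite /smx !mxE mulr_natr. Qed.

Lemma smxM n x y (i j k l : 'I_n) :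
  smx x i j * smx y k l = smx (x * y) i l *+ (j == k).
Proof.
apply/matrixP => p q; rewrite mx_mulrE (bigD1 j) //= big1 => [|r /negPf nrj].
  rewrite mulmxnE !smxE eqxx andbT addr0.
  by case: (p == i); case: (j == k); case: (q == l); rewrite ?mulr0 ?mul0r.
by rewrite smxE nrj andbF mul0r.
Qed.

Lemma smxD n (i j : 'I_n) x y : smx (x + y) i j = smx x i j + smx y i j.
Proof. exact: scalerDl. Qed.

Lemma smxN n (i j : 'I_n) x : smx (- x) i j = - smx x i j.
Proof. exact: scaleNr. Qed.

Lemma smx_sum_delta n (A : 'M[R]_n) : A = \sum_i \sum_j smx (A i j) i j.
Proof. exact: matrix_sum_delta. Qed.

Lemma smx_expr n x (i : 'I_n) k : smx x i i ^+ k.+1 = smx (x ^+ k.+1) i i.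
Proof.
elim: k => [|k IHk]; first by rewrite !expr1.
by rewrite exprS IHk smxM eqxx -exprS.
Qed.

Lemma mxtrace_smx n x (i j : 'I_n) : \tr (smx x i j) = x *+ (i == j).
Proof.
rewrite /mxtrace (bigD1 i) //= big1 => [|k /negPf nki].
  by rewrite smxE eqxx addr0.
by rewrite smxE nki.
Qed.

Lemma mxtrace_smx_expr7 n x (i j : 'I_n) :
  \tr (smx x i j ^+ 7) = x ^+ 7 *+ (i == j).
Proof.
have [<-|/negPf nij] := eqVneq i j; first by rewrite smx_expr mxtrace_smx eqxx.
by rewrite 2!exprS mulrA smxM eq_sym nij mul0r raddf0.
Qed.

Lemma mxtrace_expr7 n (B : 'M[R]_n) :
  cycle_sum (\tr (B ^+ 7) - \sum_i B i i ^+ 7).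
Proof.
pose F (p : 'I_n * 'I_n) := smx (B p.1 p.2) p.1 p.2.
have -> : \sum_i B i i ^+ 7 = \tr (\sum_p F p ^+ 7).
  rewrite raddf_sum /= (eq_bigr _ (fun p _ => mxtrace_smx_expr7 _ _ _)).
  rewrite -(pair_bigA _ (fun i j => B i j ^+ 7 *+ (i == j))) /=.
  apply: eq_bigr => i _; rewrite (bigD1 i) //= big1 ?eqxx ?addr0 // => j.
  by rewrite eq_sym => /negPf ->.
rewrite -raddfB; apply: mxtrace_cycle_sum.
(* Additivity up to seven-cycles is applied in the matrix ring, with [B] split into its entries; the
   trace carries the error into [R]. *)
rewrite [B in B ^+ 7]smx_sum_delta (pair_bigA _ (fun i j => smx (B i j) i j)).
exact: cycle_sum_expr7_sum.
Qed.

(** * Reduction to a single diagonal entry *)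

Lemma power_sum_smx1 n (i : 'I_n) : power_sum (smx 1 i i).
Proof. by apply: power_sum_idem; rewrite smxM mulr1 eqxx. Qed.

Lemma power_sum_smx n (i j : 'I_n) x : i != j -> power_sum (smx x i j).
Proof.
move=> nij; have -> : smx x i j = (smx 1 i i + smx x i j) - smx 1 i i.
  by rewrite addrC addKr.
apply: power_sumB (power_sum_smx1 i); apply: power_sum_idem.
rewrite mulrDl !mulrDr !smxM eqxx eq_sym (negPf nij) !mulr0n !mul1r.
by rewrite !addr0.
Qed.

Lemma power_sum_smx_diff n (i j : 'I_n) x y :
  i != j -> power_sum (smx (x * y) i i - smx (y * x) j j).
Proof.
move=> nij; have nji : j != i by rewrite eq_sym.
(* The coefficient [1 - y * x] is chosen so that [W * U] is the unit [smx 1 i i]. Hence [U * W] is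
   idempotent, with diagonal entries [x * y] and [1 - y * x]. *)
pose U := smx x i i + smx 1 j i; pose W := smx y i i + smx (1 - y * x) i j.
have UE : U * smx 1 i i = U by rewrite mulrDl !smxM eqxx !mulr1.
have WU : W * U = smx 1 i i.
  rewrite mulrDl !mulrDr !smxM !eqxx (negPf nij) (negPf nji) !mulr0n.
  by rewrite addr0 add0r mulr1 -smxD addrC subrK.
set d := smx (x * y) i i - _.
(* The rest of [U * W] beyond [d]: two off-diagonal terms and an idempotent, all sums of seventh
   powers. *)
pose e := smx (x * (1 - y * x)) i j + (smx y j i + smx 1 j j).
have UW : U * W = d + e.
  rewrite mulrDl 2!mulrDr !smxM eqxx !mul1r smxD smxN (addrA (smx y j i)).
  by rewrite (addrC (_ + _) (- _)) addrACA.
rewrite -[d](addrK e) -UW; apply: power_sumB; last first.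
  apply: power_sumD (power_sum_smx _ nij) _.
  exact: power_sumD (power_sum_smx _ nji) (power_sum_smx1 j).
apply: power_sum_idem.
by rewrite mulrA -(mulrA U) WU UE.
Qed.

Lemma power_sum_sub_trace n (i0 : 'I_n) (A : 'M[R]_n) :
  power_sum (A - smx (\tr A) i0 i0).
Proof.
rewrite {1}[A]smx_sum_delta /smx scaler_suml -sumrB.
apply: power_sum_sum => i _; rewrite (bigD1 i) //= addrAC.
apply: power_sumD; last first.
  by apply: power_sum_sum => j nji; apply: power_sum_smx; rewrite eq_sym.
have [->|nii0] := eqVneq i i0; first by rewrite subrr; exact: power_sum0.
(* With [y = 1], the entry [A i i] moves from position [i] to [i0]. *)
by have := power_sum_smx_diff (A i i) 1 nii0; rewrite mulr1 mul1r.
Qed.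

Lemma power_sum_trace n (i0 : 'I_n) (A : 'M[R]_n) :
  power_sum A <-> power_sum (smx (\tr A) i0 i0).
Proof.
have SA := power_sum_sub_trace i0 A; split=> [SA'|].
  by rewrite -[smx _ _ _](subKr A); apply: power_sumB.
by move=> /(power_sumD SA); rewrite subrK.
Qed.

(** * Multiples of 7 and commutators in one diagonal entry *)

Lemma smx_mulE n x (i j : 'I_n) (C : 'M[R]_n) k l :
  (smx x i j * C) k l = x * C j l *+ (k == i).
Proof.
rewrite mx_mulrE (bigD1 j) //= big1 => [|r /negPf nrj].
  by rewrite smxE eqxx andbT addr0 mulrnAl.
by rewrite smxE nrj andbF mul0r.
Qed.

(** The trace adds the weights of closed walks of length 7. Staying on the loop at [i0] gives 1. Any
    other walk goes once round the 4-cycle and three times along the loop; it has weight [x] and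
    seven possible starting points. *)
Lemma mxtrace_loop_cycle n (i0 i1 i2 i3 : 'I_n) x :
  uniq [:: i0; i1; i2; i3] ->
  \tr ((smx 1 i0 i0 + smx x i0 i1 + smx 1 i1 i2 + smx 1 i2 i3
        + smx 1 i3 i0) ^+ 7) = 1 + x *+ 7.
Proof.
move=> U; have := U; rewrite /= !inE !negb_or -!andbA.
case/and4P=> n01 n02 n03 /and3P[n12 n13 /andP[n23 _]].
have neqs := (negPf n01, negPf n02, negPf n03, negPf n12, negPf n13, negPf n23).
have neqs' := (eq_sym i1 i0, eq_sym i2 i0, eq_sym i3 i0, eq_sym i2 i1,
               eq_sym i3 i1, eq_sym i3 i2).
set B := (X in X ^+ 7).
have BE C k l : (B * C) k l =
    C i0 l *+ (k == i0) + x * C i1 l *+ (k == i0) + C i2 l *+ (k == i1) +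
    C i3 l *+ (k == i2) + C i0 l *+ (k == i3).
  have mxDE (M N : 'M[R]_n) : (M + N) k l = M k l + N k l by exact: mxE.
  by rewrite /B !mulrDl !mxDE !smx_mulE !mul1r.
have BE0 C l : (B * C) i0 l = C i0 l + x * C i1 l.
  by rewrite BE eqxx !neqs !mulr0n !addr0.
have BE1 C l : (B * C) i1 l = C i2 l.
  by rewrite BE !neqs' eqxx !neqs !mulr0n !addr0 !add0r.
have BE2 C l : (B * C) i2 l = C i3 l.
  by rewrite BE !neqs' eqxx !neqs !mulr0n !addr0 !add0r.
have BE3 C l : (B * C) i3 l = C i0 l.
  by rewrite BE !neqs' eqxx !neqs !mulr0n !add0r.
(* Rows outside the four vertices are zero in [B], so only four diagonal entries remain. *)
rewrite /mxtrace (bigID (mem [:: i0; i1; i2; i3])) /= -big_uniq //.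
rewrite [X in _ + X]big1 => [|k]; last first.
  rewrite !inE !negb_or => /and4P[/negPf k0 /negPf k1 /negPf k2 /negPf k3].
  by rewrite exprS BE k0 k1 k2 k3 !mulr0n !addr0.
have oneE k l : (1 : 'M[R]_n) k l = (k == l)%:R by exact: mxE.
rewrite !big_cons big_nil /= !exprS expr0 !(BE0, BE1, BE2, BE3) !oneE.
rewrite !eqxx !neqs' !neqs /= !(mulr0n, mulr1n, mulr0, mulr1, addr0, add0r).
by rewrite -!addrA.
Qed.

Lemma power_sum_smx_mul7 n (i0 : 'I_n) x :
  (4 <= n)%N -> power_sum (smx (x *+ 7) i0 i0).
Proof.
move=> n4; pose i k lt_k4 : 'I_n := Ordinal (leq_trans (lt_k4 : (k < 4)%N) n4).
have U : uniq [:: i 0 isT; i 1 isT; i 2 isT; i 3 isT] by [].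
rewrite -[x *+ 7](addKr 1) -(mxtrace_loop_cycle x U) addrC smxD smxN.
apply: power_sumB (power_sum_smx1 i0); apply/(iffLR (power_sum_trace i0 _)).
exact: power_sum_expr7.
Qed.

Lemma power_sum_smx_comm n (i0 : 'I_n) x y :
  (1 < n)%N -> power_sum (smx (x * y - y * x) i0 i0).
Proof.
move=> n_gt1; have [j nij] : exists j, i0 != j.
  have /card_gt0P[j] : (0 < #|predC1 i0|)%N.
    by rewrite cardC1 card_ord -subn1 subn_gt0.
  by rewrite inE eq_sym; exists j.
(* This difference has trace [x * y - y * x], which the reduction gathers at [i0]. *)
have /(iffLR (power_sum_trace i0 _)) := power_sum_smx_diff x y nij.
by rewrite raddfB /= !mxtrace_smx !eqxx.
Qed.

End Matrix.

Theorem theorem10 (R : pzRingType) (n : nat) (hn : (4 <= n <= 6)%N)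
    (A : 'M[R]_n) :
  (exists s : seq 'M[R]_n, A = \sum_(B <- s) B ^+ 7)
  <->
  (exists (c : R) (t : seq (7.-tuple R)),
     \tr A = c ^+ 7 + \sum_(a <- t) seven_cycle a).
Proof.
split=> [[s ->]|[c [t trA]]].
  rewrite raddf_sum /=.
  suff [c [t Et]] : exists c, cycle_sum (\sum_(B <- s) \tr (B ^+ 7) - c ^+ 7).
    by exists c, t; rewrite -Et addrC subrK.
  (* The seventh powers are merged twice: over the diagonal of each [B], then over [s]. *)
  exists (\sum_(B <- s) \sum_i B i i).
  have step (B : 'M[R]_n) : cycle_sum (\tr (B ^+ 7) - (\sum_i B i i) ^+ 7).
    have := cycle_sum_expr7_sum (index_enum 'I_n) (fun i => B i i).
    move=> /cycle_sumN/(cycle_sumD (mxtrace_expr7 B)).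
    by rewrite opprB addrA subrK.
  have := cycle_sum_expr7_sum s (fun B : 'M[R]_n => \sum_i B i i).
  move=> /cycle_sumN; rewrite opprB.
  move=> /(cycle_sumD (cycle_sum_sum s xpredT step)).
  by rewrite sumrB addrA subrK.
case/andP: hn => n4 _; pose i0 : 'I_n := Ordinal (ltnW (ltnW (ltnW n4))).
(* With the trace placed at [i0], the summand [c ^+ 7] is the seventh power of [smx c i0 i0], and
   the cycle sum is treated on generators. *)
apply/(power_sum_trace i0); rewrite trA smxD; apply: power_sumD.
  by rewrite -smx_expr; exact: power_sum_expr7.
have: cycle_sum (\sum_(a <- t) seven_cycle a) by exists t.
move: (\sum_(a <- t) _); apply: cycle_sum_ind => [|x y Sx Sy|x|x y].
- by rewrite /smx scale0r; exact: power_sum0.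
- by rewrite smxD; exact: power_sumD.
- exact: power_sum_smx_mul7.
- exact: power_sum_smx_comm (ltnW (ltnW n4)).
Qed.
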